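(* Let $\varphi\in C(\mathbb{R})$ satisfy: (i) $\sum_{k\in\mathbb{Z}}\varphi(u-k)=1$ for every $u\in\mathbb{R}$; (ii) $M_2(\varphi)<+\infty$ and $\lim_{r\to\infty}\sum_{|u-k|>r}|\varphi(u-k)|(k-u)^2=0$ uniformly with respect to $u\in\mathbb{R}$; (iii) $\sum_{k\in\mathbb{Z}}\varphi(u-k)(k-u)=0$ for every $u\in\mathbb{R}$. Suppose in addition that $M_\beta(\varphi)=\sup_{u\in\mathbb{R}}\sum_{k\in\mathbb{Z}}|\varphi(u-k)|\,|k-u|^{\beta}<+\infty$ for some $0<\beta<1$. Let $\{a_k\}_{k\in\mathbb{Z}}$ and $\{b_k\}_{k\in\mathbb{Z}}$ be two bounded sequences of real numbers with $b_k-a_k>0$ for all $k\in\mathbb{Z}$, and put $M^{*}=\sup_{k}\{|a_k|,|b_k|\}$. Then for any $f\in C(\mathbb{R})$, $$|(K_w^{\varphi}f)(x)-f(x)|\le\omega(f,w^{-\beta})\Big(M_\beta(\varphi)+(M^{*})^{\beta}M_0(\varphi)+M_0(\varphi)\Big)+2^{\beta+1}\|f\|_{\infty}\,w^{-\beta}M_\beta(\varphi)$$ for every $x\in\mathbb{R}$ and every $w>2M^{*}$.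
   Context: $C(\mathbb{R})$ denotes the set of all uniformly continuous and bounded functions $\mathbb{R}\to\mathbb{R}$. For real $\nu\ge 0$ the absolute moment of $\varphi$ is $M_\nu(\varphi):=\sup_{u\in\mathbb{R}}\sum_{k\in\mathbb{Z}}|\varphi(u-k)|\,|k-u|^{\nu}$. The modulus of continuity of a uniformly continuous $f:\mathbb{R}\to\mathbb{R}$ is $\omega(f,\delta):=\sup_{|x-y|\le\delta}|f(x)-f(y)|$ for $\delta>0$. For $w>0$ and sequences $\{a_k\}_{k\in\mathbb{Z}},\{b_k\}_{k\in\mathbb{Z}}$ with $\Delta_k:=b_k-a_k>0$, the generalized Kantorovich sampling series of $f\in C(\mathbb{R})$ is $$(K_w^{\varphi}f)(x)=\sum_{k=-\infty}^{\infty}\frac{w}{\Delta_k}\,\varphi(wx-k)\int_{\frac{k+a_k}{w}}^{\frac{k+b_k}{w}}f(u)\,du,\qquad x\in\mathbb{R}.$$ *)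

(* Defs.v *)
From mathcomp Require Import all_boot all_order all_algebra.
From mathcomp Require Import all_classical all_reals all_analysis.

Set Implicit Arguments.
Unset Strict Implicit.
Unset Printing Implicit Defensive.

Import Order.TTheory GRing.Theory Num.Theory.
Import numFieldNormedType.Exports.

Local Open Scope classical_set_scope.
Local Open Scope ring_scope.

(* Bilateral series of real numbers: the part over k >= 0 and the part over
   k < 0 ([Negz n] is [- n.+1]) are required to converge separately. *)
Definition zcvg (R : realType) (c : int -> R) : Prop :=
  cvgn (series (fun n : nat => c (Posz n))) /\
  cvgn (series (fun n : nat => c (Negz n))).

(* Meaningful only under [zcvg c]. *)
Definition zsum (R : realType) (c : int -> R) : R :=
  limn (series (fun n : nat => c (Posz n))) +
  limn (series (fun n : nat => c (Negz n))).

Definition zsums_to (R : realType) (c : int -> R) (s : R) : Prop :=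
  zcvg c /\ zsum c = s.

(* The space C(R) of uniformly continuous and bounded functions. *)
Definition UCB (R : realType) : set (R -> R) :=
  [set f : R -> R | unif_continuous f /\ bounded_fun f].

(* Possibly infinite.  Since [0 `^ 0 = 1], the moment of order 0 is
   [sup_u \sum_k |phi (u - k)|]. *)
Definition absmoment (R : realType) (nu : R) (phi : R -> R) : \bar R :=
  ereal_sup (range (fun u : R =>
    (\esum_(k in [set: int])
       (`|phi (u - k%:~R)| * `|k%:~R - u| `^ nu)%:E)%E)).

(* \sum_(|u - k| > r) |phi (u - k)| (k - u)^2 *)
Definition tail2 (R : realType) (phi : R -> R) (r u : R) : \bar R :=
  (\esum_(k in [set k : int | (r < `|u - k%:~R|)%R])
     (`|phi (u - k%:~R)| * (k%:~R - u) ^+ 2)%:E)%E.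

Definition modulus (R : realType) (f : R -> R) (delta : R) : R :=
  sup [set `|f p.1 - f p.2| | p in [set p : R * R | `|p.1 - p.2| <= delta]].

Definition supnorm (R : realType) (f : R -> R) : R :=
  sup (range (fun x : R => `|f x|)).

Definition Mstar (R : realType) (a b : int -> R) : R :=
  sup (range (fun k : int => `|a k|) `|` range (fun k : int => `|b k|)).

Definition kantorovich (R : realType) (phi : R -> R) (a b : int -> R)
    (w : R) (f : R -> R) (x : R) : R :=
  zsum (fun k : int =>
    w / (b k - a k) * phi (w * x - k%:~R) *
    Rintegral lebesgue_measure
      `[(k%:~R + a k) / w, (k%:~R + b k) / w] f).

(* Main.v *)
(* Since the translates of phi sum to 1, K_w f (x) - f (x) is the sum over k of
   phi (w x - k) times the difference between the mean of f over
   [(k + a_k) / w, (k + b_k) / w] and f (x).  For t in that interval,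
   |t - x| <= (M* + |k - w x|) / w.
   If |k - w x| <= w / 2, then |t - x| <= 1, so |t - x| <= |t - x|^beta, and
   omega (f, lambda delta) <= (1 + lambda) omega (f, delta) with
   delta = w^-beta, together with the subadditivity of the power beta, gives
   |f t - f x| <= (1 + |k - w x|^beta + M*^beta) omega (f, w^-beta).
   Otherwise |f t - f x| <= 2 ||f|| <= 2 ||f|| (2 |k - w x| / w)^beta.
   Summing against |phi (w x - k)| produces the moments. *)
Require Import Defs.
From mathcomp Require Import all_boot all_order all_algebra.
From mathcomp Require Import all_classical all_reals all_analysis.
From mathcomp Require Import ring lra.

Set Implicit Arguments.
Unset Strict Implicit.
Unset Printing Implicit Defensive.

Import Order.TTheory GRing.Theory Num.Theory.
Import numFieldNormedType.Exports.
Local Open Scope classical_set_scope.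
Local Open Scope ring_scope.

(** * Extended sums, subadditivity of powers, and bilateral series *)

Lemma le_esumZl (R : realType) (T : choiceType) (I : set T) (c : R)
    (g : T -> \bar R) : 0 <= c -> (forall i, 0 <= g i)%E ->
  (\esum_(i in I) (c%:E * g i) <= c%:E * \esum_(i in I) g i)%E.
Proof.
move=> c0 g0; apply: ge_ereal_sup => _ [X XI <-].
rewrite -ge0_mule_fsumr// lee_wpmul2l ?lee_fin//.
by apply: ereal_sup_ubound; exists X.
Qed.

(** A number z / (x + y) in (0, 1] is at most its own power of exponent r <= 1. The fractions for z
    = x and z = y add up to 1. *)
Lemma powR_subadd (R : realType) (x y r : R) : 0 <= x -> 0 <= y ->
  0 < r -> r <= 1 -> (x + y) `^ r <= x `^ r + y `^ r.
Proof.
move=> x0 y0 r0 r1.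
have [->|xn0] := eqVneq x 0; first by rewrite add0r lerDr powR_ge0.
have [->|yn0] := eqVneq y 0; first by rewrite addr0 lerDl powR_ge0.
have xp : 0 < x by rewrite lt_neqAle eq_sym xn0.
have yp : 0 < y by rewrite lt_neqAle eq_sym yn0.
have sp : 0 < x + y by rewrite addr_gt0.
have frac z : 0 < z -> z <= x + y ->
    (x + y) `^ r * (z / (x + y)) <= z `^ r.
  move=> zp zs; have -> : z `^ r = (x + y) `^ r * (z / (x + y)) `^ r.
    rewrite -powRM ?divr_ge0 ?(ltW zp) ?(ltW sp)//.
    by rewrite mulrC divfK ?gt_eqF.
  rewrite ler_wpM2l ?powR_ge0// ger1_powR//.
  by rewrite divr_gt0// ler_pdivrMr// mul1r zs.
have := lerD (frac _ xp _) (frac _ yp _).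
by rewrite -mulrDr -mulrDl divff ?gt_eqF// mulr1; apply; rewrite ?lerDl ?lerDr.
Qed.

(** Links the unordered sum of absolute values, in which the moments are expressed, to the two
    one-sided limits that make up [zsum]. *)
Lemma zsum_le_esum (R : realType) (c : int -> R) :
  (\esum_(k in [set: int]) `|c k|%:E < +oo)%E ->
  zcvg c /\ (`|zsum c|%:E <= \esum_(k in [set: int]) `|c k|%:E)%E.
Proof.
set E := (\esum_(_ in _) _)%E => Eoo.
have E0 : (0 <= E)%E by apply: esum_ge0.
have [S ES] : exists S, E = S%:E.
  by exists (fine E); rewrite fineK// ge0_fin_numE.
pose P (n : nat) := c (Posz n); pose N (n : nat) := c (Negz n).
(* Both halves are bounded jointly, as a sum over one finite set of distinct integers. Separate
   bounds would only give 2 S in the end. *)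
have bnd m n : series (fun i => `|P i|) m + series (fun i => `|N i|) n <= S.
  rewrite -lee_fin -ES; apply: esum_ge.
  pose r := [seq Posz i | i <- iota 0 m] ++ [seq Negz i | i <- iota 0 n].
  exists [set` r]; first by split=> //; exact: finite_seq.
  rewrite -fsbig_seq; last first.
    rewrite cat_uniq !map_inj_uniq ?iota_uniq//=; do ?by move=> ? ? [].
    by rewrite andbT; apply/hasPn => _ /mapP[i _ ->]; apply/negP => /mapP[].
  by rewrite big_cat !big_map/= !sumEFin !seriesEnat /= /index_iota !subn0.
have ser0 (u : nat -> R) n : 0 <= series (fun i => `|u i|) n.
  by rewrite seriesEnat sumr_ge0.
have cvgu (u : nat -> R) : (forall n, series (fun i => `|u i|) n <= S) ->
    cvgn (series u).
  move=> uS; apply: normed_cvg; apply: nondecreasing_is_cvgn.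
    exact: (@nondecreasing_series _ (fun i => `|u i|) xpredT 0).
  by exists S => _ [n _ <-]; exact: uS.
have cP : cvgn (series P).
  by apply: cvgu => n; rewrite (le_trans _ (bnd n 0))// lerDl ser0.
have cN : cvgn (series N).
  by apply: cvgu => n; rewrite (le_trans _ (bnd 0 n))// lerDr ser0.
split=> //; rewrite ES lee_fin /zsum -/P -/N.
rewrite -limD//.
have cPN : cvgn (series P \+ series N) by apply: is_cvgD.
rewrite -lim_norm//.
apply: limr_le; first exact: is_cvg_norm.
(* The limit of the norms is bounded along the diagonal m = n of [bnd]. *)
apply: nearW => n /=.
rewrite (le_trans (ler_normD _ _))// (le_trans _ (bnd n n))// lerD//.
  by rewrite !seriesEnat ler_norm_sum.
by rewrite !seriesEnat ler_norm_sum.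
Qed.

Lemma zsum_lincomb (R : realType) (c d : int -> R) (t : R) :
    zcvg c -> zcvg d ->
  zsum (fun k => c k + t * d k) = zsum c + t * zsum d.
Proof.
move=> [cP cN] [dP dN]; rewrite /zsum.
have lincomb (j : nat -> int) :
    cvgn (series (c \o j)) -> cvgn (series (d \o j)) ->
    limn (series (fun n => c (j n) + t * d (j n))) =
    limn (series (c \o j)) + t * limn (series (d \o j)).
  move=> cj dj; rewrite -[X in _ + X]lim_seriesZ// -lim_seriesD//.
  exact: is_cvg_seriesZ.
by rewrite (lincomb Posz)// (lincomb Negz)//= mulrDr addrACA.
Qed.

(** * Bounded functions and the modulus of continuity *)

Lemma unif_continuous_continuous (U V : uniformType) (f : U -> V) :
  unif_continuous f -> continuous f.
Proof.
move=> fu x; apply/cvg_entourageP => A /fu; rewrite /= => fA.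
exact: (cvg_entourage cvg_id fA).
Qed.

Lemma bounded_fun_le (R : realType) (T : Type) (g : T -> R) :
  bounded_fun g -> exists M, forall x, `|g x| <= M.
Proof.
by move=> [M [_ gM]]; exists (M + 1) => x; apply: gM; rewrite ?ltrDl.
Qed.

Lemma le_supnorm (R : realType) (f : R -> R) (x : R) :
  bounded_fun f -> `|f x| <= supnorm f.
Proof.
move=> /bounded_fun_le[M fM]; apply: ub_le_sup; last by exists x.
by exists M => _ [y _ <-].
Qed.

Lemma Mstar_ub (R : realType) (a b : int -> R) (k : int) :
  bounded_fun a -> bounded_fun b ->
  `|a k| <= Mstar a b /\ `|b k| <= Mstar a b.
Proof.
move=> /bounded_fun_le[A aA] /bounded_fun_le[B bB].
have ub : has_ubound (range (fun k : int => `|a k|) `|`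
                      range (fun k : int => `|b k|)).
  exists (Num.max A B) => _ [|] [i _ <-]; rewrite le_max.
    by rewrite aA.
  by rewrite bB orbT.
by split; apply: ub_le_sup => //; [left|right]; exists k.
Qed.

Lemma le_modulus (R : realType) (f : R -> R) (delta s t : R) :
  bounded_fun f -> `|s - t| <= delta -> `|f s - f t| <= modulus f delta.
Proof.
move=> /bounded_fun_le[M fM] st; apply: ub_le_sup; last by exists (s, t).
by exists (M + M) => _ [p _ <-]; rewrite (le_trans (ler_normB _ _))// lerD.
Qed.

Lemma modulus_ge0 (R : realType) (f : R -> R) (delta : R) :
  bounded_fun f -> 0 <= delta -> 0 <= modulus f delta.
Proof.
move=> fb d0.
rewrite (le_trans _ (@le_modulus _ f delta 0 0 fb _)) ?normr_ge0//.
by rewrite subrr normr0.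
Qed.

Lemma le_modulus_natmul (R : realType) (f : R -> R) (delta s t : R) (n : nat) :
  bounded_fun f -> 0 <= delta -> `|s - t| <= n%:R * delta ->
  `|f s - f t| <= n%:R * modulus f delta.
Proof.
move=> fb d0; elim: n s => [|n IHn] s.
  by rewrite !mul0r !normr_le0 !subr_eq0 => /eqP ->.
move=> st; have n0 : 0 < n.+1%:R :> R by [].
(* [p] is the first of the points cutting the segment from s to t into n + 1 equal pieces. Each
   piece has length at most [delta], and n of them remain between p and t. *)
pose p := s - (s - t) / n.+1%:R.
have -> : f s - f t = (f s - f p) + (f p - f t) by rewrite addrA subrK.
rewrite (le_trans (ler_normD _ _))// mulrSr mulrDl mul1r addrC lerD//.
  apply: IHn; have -> : p - t = (s - t) * (n%:R / n.+1%:R).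
    by rewrite /p -[in RHS]natr1; field; rewrite natr1 gt_eqF.
  rewrite normrM (ger0_norm (divr_ge0 _ _))// mulrA ler_pdivrMr//.
  by rewrite mulrAC mulrC -mulrA ler_wpM2l// mulrC.
apply: le_modulus => //.
have -> : s - p = (s - t) / n.+1%:R by rewrite /p; ring.
by rewrite normrM normfV (ger0_norm (ltW n0)) ler_pdivrMr// mulrC.
Qed.

(** The number of pieces is the integer part of [lambda] plus 1, which exceeds [lambda] and is at
    most 1 + [lambda]. *)
Lemma le_modulus_mul (R : realType) (f : R -> R) (delta lambda s t : R) :
  bounded_fun f -> 0 <= delta -> 0 <= lambda -> `|s - t| <= lambda * delta ->
  `|f s - f t| <= (1 + lambda) * modulus f delta.
Proof.
move=> fb d0 l0 st; have /andP[nl ln] := truncn_itv l0.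
have := @le_modulus_natmul _ f delta s t (Num.truncn lambda).+1 fb d0.
move/(_ _)/le_trans; apply.
  by rewrite (le_trans st)// ler_wpM2r// ltW.
by rewrite ler_wpM2r ?modulus_ge0// -natr1 addrC lerD2l.
Qed.

(** * Deviation of means and of values of f *)

Lemma Rintegral_itv_mean (R : realType) (f : R -> R) (p q y B : R) :
  continuous f -> p < q -> (forall t, p <= t <= q -> `|f t - y| <= B) ->
  `|(q - p)^-1 * Rintegral lebesgue_measure `[p, q] f - y| <= B.
Proof.
move=> fc pq fB; have qp : 0 < q - p by rewrite subr_gt0.
have icst r : \int[lebesgue_measure]_(_ in `[p, q]) r = r * (q - p).
  by rewrite Rintegral_cst//= lebesgue_measure_itv/= lte_fin pq -EFinB.
have int (g : R -> R) : continuous g ->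
    lebesgue_measure.-integrable `[p, q] (EFin \o g).
  move=> gc; apply: continuous_compact_integrable; first exact: segment_compact.
  exact: continuous_subspaceT.
have cst (r : R) : continuous (fun _ : R => r) by exact: cst_continuous.
have fyB t : t \in `[p, q] -> y - B <= f t <= y + B.
  by rewrite in_itv/= => /fB; rewrite ler_distl.
(* After multiplication by q - p both bounds are integrals of the constants y - B and y + B, so the
   integrands can be compared pointwise. *)
rewrite mulrC ler_distl ler_pdivlMr// ler_pdivrMr// -!icst.
apply/andP; split; apply: le_Rintegral => //; do ?exact: int.
  by move=> t /fyB /andP[].
by move=> t /fyB /andP[].
Qed.

(** For use with [kappa] a sampling index, t a point of its averaging interval, and M the bound M*
    on the offsets. *)
Lemma dist_le_modulus_supnorm (R : realType) (f : R -> R)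
    (beta M w x t kappa : R) :
  bounded_fun f -> 0 < beta -> beta <= 1 -> 0 <= M -> 2 * M < w ->
  `|w * t - kappa| <= M ->
  `|f t - f x| <= modulus f (w `^ (- beta)) *
                    (`|kappa - w * x| `^ beta + M `^ beta + 1)
                  + 2 `^ (beta + 1) * supnorm f * w `^ (- beta) *
                    `|kappa - w * x| `^ beta.
Proof.
move=> fb b0 b1 M0 Mw tk; set D := `|kappa - w * x|.
have w0 : 0 < w by lra.
have D0 : 0 <= D by exact: normr_ge0.
have wb0 : 0 <= w `^ (- beta) by exact: powR_ge0.
have Db0 : 0 <= D `^ beta by exact: powR_ge0.
have S0 : 0 <= supnorm f by rewrite (le_trans _ (le_supnorm x fb)).
have om0 : 0 <= modulus f (w `^ (- beta)) by exact: modulus_ge0.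
have wtx : w * `|t - x| <= D + M.
  rewrite -{1}(ger0_norm (ltW w0)) -normrM.
  have -> : w * (t - x) = (kappa - w * x) + (w * t - kappa) by ring.
  by rewrite (le_trans (ler_normD _ _))// lerD2l.
have [Dw|wD] := leP D (w / 2).
- have tx1 : `|t - x| <= 1 by rewrite -(ler_pM2l w0); lra.
  (* With lambda = (w |t - x|)^beta, the product lambda w^-beta is |t - x|^beta, which dominates |t
     - x| because |t - x| <= 1. *)
  apply: (@le_trans _ _ ((1 + (w * `|t - x|) `^ beta) *
                         modulus f (w `^ (- beta)))).
    apply: le_modulus_mul; rewrite ?powR_ge0//.
    rewrite powRM ?normr_ge0 ?(ltW w0)// mulrAC powRN.
    rewrite divff ?mul1r ?gt_eqF ?powR_gt0//.
    have [->|tx0] := eqVneq (`|t - x|) 0; first by rewrite powR_ge0.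
    by rewrite ger1_powR// tx1 lt_neqAle eq_sym tx0 normr_ge0.
  rewrite (@le_trans _ _ (modulus f (w `^ (- beta)) *
                    (D `^ beta + M `^ beta + 1)))//; last first.
    by rewrite lerDl !mulr_ge0 ?powR_ge0.
  rewrite mulrC ler_wpM2l// addrC lerD2r.
  apply: le_trans (powR_subadd D0 M0 b0 b1).
  by rewrite ge0_ler_powR// ?nnegrE ?(ltW b0) ?addr_ge0 ?mulr_ge0 ?(ltW w0).
- apply: (@le_trans _ _ (2 * supnorm f)).
    rewrite (le_trans (ler_normB _ _))//.
    by have := lerD (le_supnorm t fb) (le_supnorm x fb); lra.
  (* The product is (2 D / w)^beta, and its base exceeds 1 in this case. *)
  have ge1 : 1 <= 2 `^ beta * w `^ (- beta) * D `^ beta.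
    rewrite powRN mulrAC ler_pdivlMr ?powR_gt0// mul1r -powRM//.
    by rewrite ge0_ler_powR// ?nnegrE ?(ltW b0) ?mulr_ge0 ?(ltW w0)//; lra.
  apply: (@le_trans _ _ (2 * supnorm f *
                         (2 `^ beta * w `^ (- beta) * D `^ beta))).
    by rewrite ler_peMr// mulr_ge0.
  have -> : 2 `^ (beta + 1) = 2 `^ beta * 2 :> R.
    by rewrite powRD ?powRr1// pnatr_eq0 implybT.
  set rhs := (X in _ <= _ + X); set lhs := (X in X <= _).
  have -> : lhs = rhs by rewrite /lhs /rhs; ring.
  by rewrite lerDr mulr_ge0// !addr_ge0 ?powR_ge0.
Qed.

(** * Error estimate for the Kantorovich series *)

Theorem theorem2p3 (R : realType) (phi : R -> R) (beta : R) (a b : int -> R)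
    (phi_UCB : UCB phi)
    (phi_sum1 : forall u : R, zsums_to (fun k : int => phi (u - k%:~R)) 1)
    (phi_M2 : (absmoment 2 phi < +oo)%E)
    (phi_tail2 : forall eps : R, 0 < eps ->
       \forall r \near +oo, forall u : R, (tail2 phi r u < eps%:E)%E)
    (phi_mom1 : forall u : R,
       zsums_to (fun k : int => phi (u - k%:~R) * (k%:~R - u)) 0)
    (beta_gt0 : 0 < beta) (beta_lt1 : beta < 1)
    (phi_Mbeta : (absmoment beta phi < +oo)%E)
    (a_bnd : bounded_fun a) (b_bnd : bounded_fun b)
    (ab_gt0 : forall k : int, 0 < b k - a k) :
  forall f : R -> R, UCB f ->
  forall x w : R, 2 * Mstar a b < w ->
    (`|kantorovich phi a b w f x - f x|%:E <=
     (modulus f (w `^ (- beta)))%:E *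
       (absmoment beta phi + (Mstar a b `^ beta)%:E * absmoment 0 phi
        + absmoment 0 phi)
     + (2 `^ (beta + 1) * supnorm f * w `^ (- beta))%:E
       * absmoment beta phi)%E.
Proof.
move=> f [fu fb] x w Mw; have fc := unif_continuous_continuous fu.
set M := Mstar a b; set om := modulus f _; set C := 2 `^ _ * _ * _.
have M0 : 0 <= M.
  by case: (Mstar_ub 0 a_bnd b_bnd) => aM _; rewrite (le_trans _ aM).
have w0 : 0 < w by move: Mw; rewrite -/M; lra.
have om0 : 0 <= om by apply: modulus_ge0 => //; exact: powR_ge0.
have C0 : 0 <= C.
  by rewrite !mulr_ge0 ?powR_ge0// (le_trans _ (le_supnorm x fb)).
set u := w * x.
pose p k := `|phi (u - k%:~R)|; pose q k := p k * `|k%:~R - u| `^ beta.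
have p0 k : 0 <= p k by exact: normr_ge0.
have q0 k : 0 <= q k by rewrite mulr_ge0 ?powR_ge0.
pose avg k := (b k - a k)^-1 * w *
  Rintegral lebesgue_measure `[(k%:~R + a k) / w, (k%:~R + b k) / w] f.
pose d k := phi (u - k%:~R) * (avg k - f x).
have dE k : `|d k| <= om * (q k + M `^ beta * p k + p k) + C * q k.
  have avgB : `|avg k - f x| <=
      om * (`|k%:~R - u| `^ beta + M `^ beta + 1) + C * `|k%:~R - u| `^ beta.
    have [aM bM] := Mstar_ub k a_bnd b_bnd; have ab := ab_gt0 k.
    have -> : avg k = ((k%:~R + b k) / w - (k%:~R + a k) / w)^-1 *
        Rintegral lebesgue_measure `[(k%:~R + a k) / w, (k%:~R + b k) / w] f.
      by rewrite /avg; congr (_ * _); field; rewrite !gt_eqF//; lra.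
    apply: Rintegral_itv_mean => //.
      by rewrite ltr_pM2r ?invr_gt0//; lra.
    (* Here w t - k lies between a_k and b_k, hence in [-M, M]. *)
    move=> t; rewrite ler_pdivrMr// ler_pdivlMr// => /andP[ta tb].
    apply: dist_le_modulus_supnorm => //; first exact: ltW.
    move: aM bM; rewrite -/M !ler_norml => /andP[? ?] /andP[? ?].
    by apply/andP; split; lra.
  rewrite /d normrM -/(p k) (le_trans (ler_wpM2l (p0 k) avgB))// /q.
  set lhs := (X in X <= _); set rhs := (X in _ <= X).
  by have -> : lhs = rhs by rewrite /lhs /rhs; ring.
(* From here on [om] and [C] act as nonnegative constants, tied to [d] only through [dE]. *)
clearbody om C.
have le_moment nu : (\esum_(k in [set: int]) (p k * `|k%:~R - u| `^ nu)%:E <=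
    absmoment nu phi)%E.
  by apply: ereal_sup_ubound; exists u.
have le0 : (\esum_(k in [set: int]) (p k)%:E <= absmoment 0 phi)%E.
  apply: le_trans (le_moment 0); apply: le_esum => k _.
  by rewrite powRr0 mulr1.
have leb : (\esum_(k in [set: int]) (q k)%:E <= absmoment beta phi)%E.
  exact: le_moment.
set RHS := (leRHS).
have dR : (\esum_(k in [set: int]) `|d k|%:E <= RHS)%E.
  pose e k : \bar R :=
    (om%:E * ((q k)%:E + (M `^ beta)%:E * (p k)%:E + (p k)%:E)
     + C%:E * (q k)%:E)%E.
  apply: (@le_trans _ _ (\esum_(k in [set: int]) e k)%E).
    by apply: le_esum => k _; rewrite lee_fin.
  rewrite esumD => [|k _|k _];
    rewrite ?lee_fin ?mulr_ge0 ?addr_ge0 ?mulr_ge0 ?powR_ge0//.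
  apply: leeD.
    apply: (le_trans (le_esumZl _ om0 _)) => [k|].
      by rewrite lee_fin ?addr_ge0 ?mulr_ge0 ?powR_ge0.
    rewrite lee_wpmul2l ?lee_fin//.
    rewrite esumD => [|k _|k _];
      rewrite ?lee_fin ?addr_ge0 ?mulr_ge0 ?powR_ge0//.
    rewrite esumD => [|k _|k _];
      rewrite ?lee_fin ?addr_ge0 ?mulr_ge0 ?powR_ge0//.
    apply: leeD => //; apply: leeD => //.
    apply: (le_trans (le_esumZl _ (powR_ge0 _ _) _)) => [k|].
      by rewrite lee_fin.
    by rewrite lee_wpmul2l ?lee_fin ?powR_ge0.
  apply: (le_trans (le_esumZl _ C0 _)) => [k|]; first by rewrite lee_fin.
  by rewrite lee_wpmul2l ?lee_fin.
(* An infinite bound is immediate. A finite one makes [d] absolutely summable, which yields its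
   convergence. *)
have [RHSoo|] := ltP RHS +oo%E; last by rewrite leye_eq => /eqP ->; exact: leey.
have [cd dS] := zsum_le_esum (le_lt_trans dR RHSoo).
have [cphi phi1] := phi_sum1 u.
have -> : kantorovich phi a b w f x - f x = zsum d; last exact: le_trans dS dR.
(* f(x) is written as f(x) times the sum of the translates, then moved to the side of [d], so that
   linearity is applied to two series already known to converge. *)
rewrite /kantorovich -[X in _ - X]mulr1 -[X in _ - _ * X]phi1.
apply/eqP; rewrite subr_eq -zsum_lincomb//; apply/eqP; congr zsum.
by apply/funext => k; rewrite /d /avg -/u; ring.
Qed.
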